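(* Consider the Top-in-at-random chain on the permutations of $(1,\dots,n)$ with target set $G=\{(1,2,\dots,n)\}$, and let $\alpha\in(0,1)$. For every sequence $(R_n)$ with $n\log n\ll R_n\ll(n-2)!$, there are sequences $d_n,f_n,r_n\to0$ (as $n\to\infty$) such that condition $Hp.G(R_n,d_n,f_n,r_n)$ holds.
   Context: Top-in-at-random (TIAR) model: the state space $\mathcal X^{(n)}$ is the set of permutations $x=(x_1,\dots,x_n)$ of $(1,\dots,n)$. At each (discrete) time step the chain moves from $x$ to $x^k=(x_2,\dots,x_k,x_1,x_{k+1},\dots,x_n)$ with $k$ uniform in $\{1,\dots,n\}$. The invariant measure $\pi$ is uniform. $a_n\ll b_n$ means $a_n/b_n\to0$. General notation and hypotheses (times are integers for this discrete-time chain). For an irreducible Markov chain $X$ on a finite set $\mathcal X$ with kernel $P$ and invariant probability $\pi$, $X^{\leftarrow}$ denotes the time-reversed chain, with kernel $P^*(x,y)=\frac{\pi(y)}{\pi(x)}P(y,x)$. A superscript $x$ (or a probability measure) denotes the starting point (or initial law); $\tau^x_K=\inf\{t\ge0:X^x_t\in K\}$ and $\tau^{\leftarrow x}_K$ is the same for $X^{\leftarrow}$. For $G\subset\mathcal X$, $A=\mathcal X\setminus G$, $\pi_A(\cdot)=\pi(\cdot)\mathbf 1_{\{\cdot\in A\}}/\pi(A)$. $d_{TV}(\pi_1,\pi_2)=\frac12\sum_x|\pi_1(x)-\pi_2(x)|$, $\mu^x_t(\cdot)=\mathbf P(X^x_t=\cdot)$, $\bar d_K(t)=\max_{x,x'\in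 K}d_{TV}(\mu^x_t,\mu^{x'}_t)$. Let $f_A(t):=\mathbf P(\tau_G^{\pi_A}\le t)$. For $R>1$, $d,f,r\in(0,1)$, $\alpha\in(0,1)$: - $E(R,f)$: $f_A(2R)\le f$. - $B_\alpha:=\left\{x\in A:\ \frac12\left[\mathbf P(\tau_G^x\le2R)+\mathbf P(\tau_G^{\leftarrow x}\le2R)\right]\le f^\alpha\right\}$. - $T(R,d)$: $\bar d_{B_\alpha}(R)\le d$. - $Rc(R,r)$: $\sup_{x\in\mathcal X}\mathbf P(\tau^x_{B_\alpha\cup G}>R)<r$. - $Hp.G(R,d,f,r)$: $E(R,f)$, $T(R,d)$ and $Rc(R,r)$ hold simultaneously. *)

(* Defs.v *)
From HB Require Import structures.
From mathcomp Require Import all_boot all_order all_algebra all_fingroup.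
From mathcomp Require Import all_classical all_reals all_analysis.

Set Implicit Arguments.
Unset Strict Implicit.
Unset Printing Implicit Defensive.

Import Order.TTheory GRing.Theory Num.Theory.
Import numFieldNormedType.Exports.

Local Open Scope ring_scope.

(* A kernel is a function P : X -> X -> K on a finite type X.  Events that only
   depend on (X_0, ..., X_t) are predicates on t.+1-tuples, and their
   probability is computed with the joint law of (X_0, ..., X_t) when
   X_0 has law nu. *)
Definition traj_law (K : realType) (X : finType) (P : X -> X -> K)
    (nu : X -> K) (t : nat) (w : t.+1.-tuple X) : K :=
  nu (tnth w ord0) *
  \prod_(i < t) P (tnth w (widen_ord (leqnSn t) i)) (tnth w (lift ord0 i)).

Definition prob (K : realType) (X : finType) (P : X -> X -> K)
    (nu : X -> K) (t : nat) (E : pred (t.+1.-tuple X)) : K :=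
  \sum_(w : t.+1.-tuple X | E w) traj_law P nu w.

Definition point_mass (K : realType) (X : finType) (x : X) : X -> K :=
  fun y => (x == y)%:R.

(* On the trajectory (X_0, ..., X_t), [find] returns the first time at which
   the set S is visited, and t.+1 if there is none; so its value is
   min (tau_S) (t + 1), which decides both {tau_S <= t} and {tau_S > t}. *)
Definition hitting_time (X : finType) (S : {set X}) (t : nat)
    (w : t.+1.-tuple X) : nat :=
  find (fun y => y \in S) w.

Definition prob_hit_le (K : realType) (X : finType) (P : X -> X -> K)
    (nu : X -> K) (S : {set X}) (t : nat) : K :=
  prob P nu (fun w : t.+1.-tuple X => (hitting_time S w <= t)%N).

Definition prob_hit_gt (K : realType) (X : finType) (P : X -> X -> K)
    (nu : X -> K) (S : {set X}) (t : nat) : K :=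
  prob P nu (fun w : t.+1.-tuple X => (t < hitting_time S w)%N).

Definition law_at (K : realType) (X : finType) (P : X -> X -> K)
    (x : X) (t : nat) : X -> K :=
  fun y => prob P (point_mass K x) (fun w : t.+1.-tuple X => tnth w ord_max == y).

Definition reversed (K : realType) (X : finType) (P : X -> X -> K)
    (pi : X -> K) : X -> X -> K :=
  fun x y => pi y / pi x * P y x.

Definition conditioned (K : realType) (X : finType) (pi : X -> K)
    (A : {set X}) : X -> K :=
  fun x => pi x * (x \in A)%:R / \sum_(y in A) pi y.

Definition dTV (K : realType) (X : finType) (mu nu : X -> K) : K :=
  2^-1 * \sum_(x : X) `|mu x - nu x|.

(* The default value 0 of the maximum matters only when S is empty. *)
Definition dbar (K : realType) (X : finType) (P : X -> X -> K)
    (S : {set X}) (t : nat) : K :=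
  \big[Num.max/0]_(x in S) \big[Num.max/0]_(x' in S)
    dTV (law_at P x t) (law_at P x' t).

Definition cond_E (K : realType) (X : finType) (P : X -> X -> K)
    (pi : X -> K) (G : {set X}) (R : nat) (f : K) : Prop :=
  prob_hit_le P (conditioned pi (~: G)) G (2 * R) <= f.

Definition Bset (K : realType) (X : finType) (P : X -> X -> K)
    (pi : X -> K) (G : {set X}) (alpha : K) (R : nat) (f : K) : {set X} :=
  [set x in ~: G |
    2^-1 * (prob_hit_le P (point_mass K x) G (2 * R) +
            prob_hit_le (reversed P pi) (point_mass K x) G (2 * R))
    <= f `^ alpha].

Definition cond_T (K : realType) (X : finType) (P : X -> X -> K)
    (pi : X -> K) (G : {set X}) (alpha : K) (R : nat) (f d : K) : Prop :=
  dbar P (Bset P pi G alpha R f) R <= d.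

Definition cond_Rc (K : realType) (X : finType) (P : X -> X -> K)
    (pi : X -> K) (G : {set X}) (alpha : K) (R : nat) (f r : K) : Prop :=
  \big[Num.max/0]_(x : X)
    prob_hit_gt P (point_mass K x) (Bset P pi G alpha R f :|: G) R < r.

Definition HpG (K : realType) (X : finType) (P : X -> X -> K)
    (pi : X -> K) (G : {set X}) (alpha : K) (R : nat) (d f r : K) : Prop :=
  [/\ cond_E P pi G R f,
      cond_T P pi G alpha R f d &
      cond_Rc P pi G alpha R f r].

(* A deck is x : 'S_n, with x i the card in position i; positions and cards are
   numbered from 0.  [tiar_shift k] maps position k to 0, shifts the positions
   i < k to i + 1 and fixes the positions i > k. *)
Definition tiar_shift (n : nat) : 'I_n -> 'S_n :=
  match n with
  | 0 => fun _ => 1%g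
  | _.+1 => fun k => lift_perm k ord0 1%g
  end.

(* Permutations compose from left to right: (s * x) i = x (s i). *)
Definition tiar_move (n : nat) (k : 'I_n) (x : 'S_n) : 'S_n :=
  (tiar_shift k * x)%g.

Definition tiar_kernel (K : realType) (n : nat) (x y : 'S_n) : K :=
  #|[set k : 'I_n | tiar_move k x == y]|%:R / n%:R.

Definition uniform_law (K : realType) (X : finType) : X -> K :=
  fun _ => (#|X|%:R)^-1.

Definition tiar_target (n : nat) : {set 'S_n} := [set 1%g].

Local Open Scope classical_set_scope.

(* Division by zero gives zero, hence the first clause. *)
Definition much_less (K : realType) (a b : nat -> K) : Prop :=
  (\forall n \near \oo, b n != 0) /\ (fun n => a n / b n) @ \oo --> (0 : K).

Lemma tiar_moveE (n : nat) (k : 'I_n.+1) (x : 'S_n.+1) (i : 'I_n.+1) :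
  tiar_move k x i =
  if (i < k)%N then x (inord i.+1) else if i == k then x ord0 else x i.
Proof.
rewrite /tiar_move /tiar_shift permM.
have [->|ik] := eqVneq i k; first by rewrite ltnn lift_perm_id.
have ki : k != i by rewrite eq_sym.
have [j -> _] := unlift_some ki.
rewrite lift_perm_lift perm1; have := ltn_ord j; rewrite /= /bump => jn.
case: (leqP k j) => kj /=.
  rewrite add1n ltnNge ltnW //=; congr (x _); apply: val_inj.
  by rewrite /= /bump kj.
rewrite add0n kj; congr (x _); apply: val_inj.
by rewrite /= /bump inordK // ltnS.
Qed.

Lemma tiar_kernel_stochastic (K : realType) (n : nat) (x : 'S_n.+1) :
  \sum_(y : 'S_n.+1) tiar_kernel K x y = 1.
Proof.
rewrite -mulr_suml -natr_sum.
under eq_bigr do rewrite -sum1dep_card.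
rewrite (exchange_big_dep xpredT) //=.
under eq_bigr do (under eq_bigl do rewrite eq_sym; rewrite big_pred1_eq).
by rewrite sum1_card card_ord divff // pnatr_eq0.
Qed.

Lemma tiar_kernel_invariant (K : realType) (n : nat) (y : 'S_n.+1) :
  \sum_(x : 'S_n.+1) uniform_law K x * tiar_kernel K x y = uniform_law K y.
Proof.
rewrite /uniform_law -mulr_sumr -mulr_suml -natr_sum.
under eq_bigr do rewrite -sum1dep_card.
rewrite (exchange_big_dep xpredT) //=.
have E (k : 'I_n.+1) :
    (\sum_(x : 'S_n.+1 | tiar_move k x == y) 1 = 1)%N.
  rewrite (eq_bigl (pred1 ((tiar_shift k)^-1 * y)%g)) ?big_pred1_eq // => x.
  by rewrite /= /tiar_move -(inj_eq (mulgI (tiar_shift k)^-1%g)) mulKg.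
under eq_bigr do rewrite E.
by rewrite sum1_card card_ord divff ?mulr1 // pnatr_eq0.
Qed.

(* Main.v *)
Require Import Defs.
From HB Require Import structures.
From mathcomp Require Import all_boot all_order all_algebra all_fingroup.
From mathcomp Require Import all_classical all_reals all_analysis.
From mathcomp Require Import zify ring lra.

Import Order.TTheory GRing.Theory Num.Theory.
Import numFieldNormedType.Exports.

Local Open Scope classical_set_scope.
Local Open Scope ring_scope.

(* Mixing.  The reversed chain moves a uniform card to the top.  Two copies that
   always move the same card agree as soon as every card has been moved, so
   coupon collecting bounds the distance of their laws by 2 n (1 - 1/n)^t in L1.
   Both chains are random walks on 'S_n, with increments inverse to each other,
   hence they are at the same distance from the uniform law; for R >= 3 n ln n
   this distance is at most 2 / n^2.
   Hitting.  From a stationary start, a union bound over times gives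
   P(tau_G <= 2 R) <= (2 R + 1) / n! for both directions of time.  This yields
   condition E, and by Markov's inequality pi(A \ B_alpha) <= f^(1 - alpha).  Then
   P(tau^x_(B u G) > R) <= P(X^x_R \notin B u G) <= f^(1 - alpha) + 2 / n^2.
   One can take d = f = 1 / (n + 2). *)

(** * Trajectory laws, powers of a kernel and hitting times *)

Section Trajectories.
Context {K : realType} {X : finType}.
Implicit Types (P : X -> X -> K) (nu pi : X -> K) (S G : {set X}).

Definition stochastic P :=
  (forall x y, 0 <= P x y) /\ (forall x, \sum_y P x y = 1).

Definition invariant_law P nu := forall y, \sum_x nu x * P x y = nu y.

Fixpoint kpow P t x y : K :=
  if t is t'.+1 then \sum_z P x z * kpow P t' z y else (x == y)%:R.

Lemma sum_point_mass (F : X -> K) y : \sum_x (y == x)%:R * F x = F y.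
Proof.
rewrite (bigD1 y) //= eqxx mul1r big1 ?addr0 // => i.
by rewrite eq_sym => /negbTE ->; rewrite mul0r.
Qed.

(** Splitting off the last step is what the reversed chain needs: its first step acts on the
    endpoint [y]. *)
Lemma kpowSr P t x y : kpow P t.+1 x y = \sum_z kpow P t x z * P z y.
Proof.
elim: t x => [|t IH] x.
  rewrite /= sum_point_mass (bigD1 y) //= eqxx mulr1 big1 ?addr0 // => z.
  by move=> /negbTE ->; rewrite mulr0.
rewrite [LHS]/=; under eq_bigr => z _.
  rewrite -/(kpow P t.+1 z y) IH mulr_sumr.
  over.
rewrite exchange_big /=; apply: eq_bigr => z _.
by rewrite mulr_suml; apply: eq_bigr => v _; rewrite mulrA.
Qed.

Lemma kpow_stochastic P t : stochastic P -> stochastic (kpow P t).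
Proof.
move=> [P0 P1]; elim: t => [|t [IH0 IH1]]; split=> x.
- by move=> y; rewrite ler0n.
- by rewrite -[RHS](sum_point_mass (fun=> 1) x); apply: eq_bigr => y _; rewrite mulr1.
- by move=> y; apply: sumr_ge0 => z _; rewrite mulr_ge0.
- rewrite exchange_big /= -[RHS](P1 x); apply: eq_bigr => z _.
  by rewrite -mulr_sumr IH1 mulr1.
Qed.

Lemma big_cons_tuple t (E : pred (t.+1.-tuple X)) (F : t.+1.-tuple X -> K) :
  \sum_(w | E w) F w =
  \sum_x \sum_(w : t.-tuple X | E [tuple of x :: w]) F [tuple of x :: w].
Proof.
rewrite pair_big_dep /=.
rewrite (reindex (fun p : X * t.-tuple X => [tuple of p.1 :: p.2])) //=.
exists (fun w => (thead w, [tuple of behead w])) => [[x w] _|w _] /=.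
  by congr pair; apply: val_inj.
by rewrite -tuple_eta.
Qed.

Lemma prob0 P nu (E : pred (1.-tuple X)) :
  prob P nu E = \sum_(x | E [tuple of [:: x]]) nu x.
Proof.
rewrite /prob big_cons_tuple [RHS]big_mkcond /=; apply: eq_bigr => x _.
rewrite (eq_bigl (fun w => (w == [tuple]) && E [tuple of [:: x]])); last first.
  by move=> w; rewrite (tuple0 w) eqxx; congr E; apply: val_inj.
case: ifP => Ex; last by rewrite big_pred0 // => w; rewrite andbF.
under eq_bigl do rewrite andbT.
by rewrite big_pred1_eq /traj_law big_ord0 mulr1.
Qed.

(** This is the Markov property: given X_0 = x, the remaining trajectory starts from the law [P x].
    It drives the inductions on the length of trajectories. *)
Lemma prob_cons P nu t (E : pred (t.+2.-tuple X)) :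
  prob P nu E =
  \sum_x nu x * prob P (P x) (fun w : t.+1.-tuple X => E [tuple of x :: w]).
Proof.
rewrite /prob big_cons_tuple; apply: eq_bigr => x _; rewrite mulr_sumr.
apply: eq_bigr => w _; rewrite /traj_law big_ord_recl /=.
have -> : tnth [tuple of x :: w] ord0 = x by [].
congr (_ * (P _ _ * _)); first by rewrite tnthS.
apply: eq_bigr => i _; rewrite tnthS; congr (P _ _).
by rewrite -(tnthS x w); congr tnth; apply: val_inj.
Qed.

Lemma prob_linear P (I : finType) (a : I -> K) (nu : I -> X -> K) t
    (E : pred (t.+1.-tuple X)) :
  prob P (fun y => \sum_i a i * nu i y) E = \sum_i a i * prob P (nu i) E.
Proof.
rewrite /prob; under [RHS]eq_bigr do rewrite mulr_sumr.
rewrite [RHS]exchange_big /=; apply: eq_bigr => w _.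
by rewrite /traj_law mulr_suml; apply: eq_bigr => i _; rewrite mulrA.
Qed.

Lemma eq_prob P nu nu' t (E : pred (t.+1.-tuple X)) :
  nu =1 nu' -> prob P nu E = prob P nu' E.
Proof. by move=> h; apply: eq_bigr => w _; rewrite /traj_law h. Qed.

Lemma traj_law_ge0 P nu t (w : t.+1.-tuple X) :
  stochastic P -> (forall x, 0 <= nu x) -> 0 <= traj_law P nu w.
Proof. by move=> [P0 _] nu0; rewrite mulr_ge0 // prodr_ge0. Qed.

Lemma le_prob P nu nu' t (E E' : pred (t.+1.-tuple X)) :
  stochastic P -> (forall x, 0 <= nu x <= nu' x) -> subpred E E' ->
  prob P nu E <= prob P nu' E'.
Proof.
move=> sP hnu EE'; rewrite /prob.
apply: (@le_trans _ _ (\sum_(w | E' w) traj_law P nu w)).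
  rewrite [leRHS](bigID E) /= [leLHS](eq_bigl (fun w => E' w && E w)).
    rewrite lerDl sumr_ge0 // => w _; apply: traj_law_ge0 => // x.
    by case/andP: (hnu x).
  by move=> w; case Ew: (E w); rewrite ?andbF // (EE' _ Ew).
apply: ler_sum => w _; rewrite ler_wpM2r ?prodr_ge0 //.
  by move=> i _; case: sP.
by case/andP: (hnu (tnth w ord0)).
Qed.

Lemma prob_predT P nu t : stochastic P ->
  prob P nu (fun _ : t.+1.-tuple X => true) = \sum_x nu x.
Proof.
move=> sP; elim: t nu => [|t IH] nu; first by rewrite prob0.
by rewrite prob_cons; apply: eq_bigr => x _; rewrite IH (proj2 sP) mulr1.
Qed.

Lemma prob_at_invariant P nu t (i : 'I_t.+1) S :
  stochastic P -> invariant_law P nu ->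
  prob P nu (fun w : t.+1.-tuple X => tnth w i \in S) = \sum_(y in S) nu y.
Proof.
move=> sP inu; elim: t i => [|t IH] i.
  by rewrite prob0; apply: eq_bigl => x; rewrite (ord1 i).
(* A positive index moves back by one, because the law after one step is again [nu]; at index 0 the
   rest of the trajectory has total mass 1. *)
rewrite prob_cons; case: (unliftP ord0 i) => [j|] ->.
  rewrite -(IH j) -(eq_prob P _ _ t _ inu) prob_linear.
  apply: eq_bigr => x _; congr (_ * _).
  by apply: eq_bigl => w; rewrite tnthS.
rewrite big_mkcond [RHS]big_mkcond; apply: eq_bigr => x _ /=.
case: ifP => xS; first by rewrite prob_predT // (proj2 sP) mulr1.
by rewrite /prob big_pred0 ?mulr0.
Qed.

Lemma prob_last P nu t y :
  prob P nu (fun w : t.+1.-tuple X => tnth w ord_max == y) =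
  \sum_x nu x * kpow P t x y.
Proof.
elim: t nu => [|t IH] nu.
  rewrite prob0 big_mkcond; apply: eq_bigr => x _ /=.
  rewrite (_ : tnth _ _ = x); last by rewrite (ord1 ord_max).
  by case: eqP; rewrite ?mulr1 ?mulr0.
rewrite prob_cons; apply: eq_bigr => x _; rewrite /= -IH; congr (_ * _).
apply: eq_bigl => w; congr (_ == _).
by rewrite (_ : ord_max = lift ord0 ord_max) ?tnthS //; apply: val_inj.
Qed.

Lemma law_atE P x t y : law_at P x t y = kpow P t x y.
Proof. by rewrite /law_at prob_last sum_point_mass. Qed.

Lemma hitting_time_leP S t (w : t.+1.-tuple X) :
  reflect (exists i, tnth w i \in S) (hitting_time S w <= t)%N.
Proof.
rewrite /hitting_time -ltnS -[in X in (_ < X)%N](size_tuple w) -has_find.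
by apply: (iffP hasP) => [[x /tnthP[i ->] xS]|[i iS]];
  [exists i|exists (tnth w i) => //; apply: mem_tnth].
Qed.

Lemma prob_hit_le_invariant P nu S t :
  stochastic P -> (forall x, 0 <= nu x) -> invariant_law P nu ->
  prob_hit_le P nu S t <= t.+1%:R * \sum_(y in S) nu y.
Proof.
move=> sP nu0 inu.
have -> : t.+1%:R * \sum_(y in S) nu y =
    \sum_(i < t.+1) prob P nu (fun w : t.+1.-tuple X => tnth w i \in S).
  rewrite mulr_natl -[X in _ *+ X](card_ord t.+1) -sumr_const.
  by apply: eq_bigr => i _; rewrite (prob_at_invariant P nu t i S sP inu).
rewrite /prob_hit_le /prob.
under [leRHS]eq_bigr do rewrite big_mkcond /=.
(* Each trajectory is now counted once per visit to [S], hence at least once if it hits. *)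
rewrite exchange_big /= big_mkcond; apply: ler_sum => w _.
have w0 : 0 <= traj_law P nu w by apply: traj_law_ge0.
case: ifP => [/hitting_time_leP[i iS]|_].
  rewrite (bigD1 i) //= iS lerDl sumr_ge0 // => j _.
  by case: ifP.
by apply: sumr_ge0 => i _; case: ifP.
Qed.

Lemma prob_hit_gt_le_last P x S t : stochastic P ->
  prob_hit_gt P (point_mass K x) S t <= \sum_(y | y \notin S) kpow P t x y.
Proof.
move=> sP.
apply: (@le_trans _ _ (prob P (point_mass K x)
    (fun w : t.+1.-tuple X => tnth w ord_max \notin S))).
  apply: le_prob => // [z|w]; first by rewrite /point_mass ler0n lexx.
  rewrite ltnNge; apply: contra => wS; apply/hitting_time_leP.
  by exists ord_max.
under [leRHS]eq_bigr do rewrite -law_atE.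
rewrite /law_at /prob.
by rewrite (partition_big (fun w => tnth w ord_max) (fun y => y \notin S)) //=;
  apply: ler_sum => y yS; rewrite le_eqVlt; apply/orP; left; apply/eqP;
  apply: eq_bigl => w; case: eqP => [->|]; rewrite ?yS ?andbF.
Qed.

(** Reversal exchanges two properties: invariance of [pi] becomes the row sums here, and the row
    sums of [P] become invariance in the next lemma. *)
Lemma reversed_stochastic P pi : stochastic P -> (forall x, 0 < pi x) ->
  invariant_law P pi -> stochastic (reversed P pi).
Proof.
move=> [P0 _] pi0 ipi; split=> [x y|x].
  by rewrite mulr_ge0 // divr_ge0 // ltW.
rewrite /reversed; under eq_bigr do rewrite mulrAC.
by rewrite -mulr_suml ipi divff // gt_eqF.
Qed.

Lemma reversed_invariant P pi : stochastic P -> (forall x, 0 < pi x) ->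
  invariant_law (reversed P pi) pi.
Proof.
move=> [_ P1] pi0 y; rewrite -[RHS]mulr1 -(P1 y) mulr_sumr.
apply: eq_bigr => x _; rewrite /reversed.
by rewrite mulrA [pi x * _]mulrC divfK // gt_eqF.
Qed.

(** * Hitting a target from the stationary law *)

Section Target.
Variables (P : X -> X -> K) (pi : X -> K) (G : {set X}).
Hypotheses (sP : stochastic P) (pi0 : forall x, 0 < pi x).
Hypothesis ipi : invariant_law P pi.

(** The conditioned law is at most [pi] divided by the mass of the complement of [G], so the
    stationary union bound applies up to that factor. *)
Lemma cond_E_bound R f :
  (2 * R).+1%:R * (\sum_(y in G) pi y) <= f * \sum_(y in ~: G) pi y ->
  0 < \sum_(y in ~: G) pi y ->
  cond_E P pi G R f.
Proof.
set A := \sum_(y in ~: G) _ => le_f A0.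
rewrite /cond_E /prob_hit_le.
(* The sum over 'I_1 lets prob_linear serve as homogeneity in the law. *)
apply: (@le_trans _ _ (prob P (fun y => \sum_(i < 1) A^-1 * pi y)
    (fun w : (2 * R).+1.-tuple X => (hitting_time G w <= 2 * R)%N))).
  apply: le_prob => // x; rewrite big_ord1 /conditioned -/A.
  have px := ltW (pi0 x); have A1 : 0 <= A^-1 by rewrite invr_ge0 ltW.
  case: (x \in _); rewrite ?mulr1 ?mulr0 ?mul0r ?lexx ?mulr_ge0 //.
  by rewrite mulrC lexx.
rewrite (prob_linear P 'I_1 (fun=> A^-1) (fun=> pi)) big_ord1.
rewrite mulrC ler_pdivrMr //; apply: le_trans le_f.
by apply: prob_hit_le_invariant => // x; apply: ltW.
Qed.

Lemma sum_prob_hit_le (Q : X -> X -> K) t :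
  stochastic Q -> invariant_law Q pi ->
  \sum_x pi x * prob_hit_le Q (point_mass K x) G t <=
  t.+1%:R * \sum_(y in G) pi y.
Proof.
move=> sQ iQ; rewrite /prob_hit_le -prob_linear.
rewrite (eq_prob Q _ pi); last first.
  move=> y; rewrite -[RHS](sum_point_mass pi y); apply: eq_bigr => x _.
  by rewrite mulrC /point_mass eq_sym.
by apply: prob_hit_le_invariant => // x; apply: ltW.
Qed.

(* Markov's inequality for the average of the two hitting probabilities. *)
Lemma Bset_compl_bound alpha R f : 0 < f ->
  (\sum_(y | y \notin Bset P pi G alpha R f :|: G) pi y) * f `^ alpha <=
  (2 * R).+1%:R * \sum_(y in G) pi y.
Proof.
move=> f0; rewrite mulr_suml.
set h := fun x => 2^-1 * (prob_hit_le P (point_mass K x) G (2 * R) +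
  prob_hit_le (reversed P pi) (point_mass K x) G (2 * R)).
have sQ := reversed_stochastic _ _ sP pi0 ipi.
have iQ := reversed_invariant _ _ sP pi0.
have h0 x : 0 <= h x.
  by rewrite mulr_ge0 ?invr_ge0 // addr_ge0 // sumr_ge0 // => w _;
    apply: traj_law_ge0 => // z; rewrite ler0n.
apply: (@le_trans _ _ (\sum_x pi x * h x)).
  rewrite big_mkcond; apply: ler_sum => x _; case: ifPn => [xB|_]; last first.
    by rewrite mulr_ge0 // ltW.
  rewrite ler_wpM2l ?(ltW (pi0 x)) // leNgt; apply: contra xB => hx.
  by rewrite !inE orbC; case: (x \in G) => //=; apply: ltW.
rewrite /h; under eq_bigr do rewrite mulrCA mulrDr.
rewrite -mulr_sumr big_split /= mulrC ler_pdivrMr // mulr_natr mulr2n.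
by apply: lerD; apply: sum_prob_hit_le.
Qed.

End Target.
End Trajectories.

(** * Mixing through a coupling of the reversed walk *)

Section Mixing.
Context {K : realType} {n : nat}.
Local Notation S := 'S_n.+1.
Local Notation P := (@tiar_kernel K n.+1).
Implicit Types (x y g : S) (A : {set 'I_n.+1}).

Lemma tiar_kernel_is_stochastic : stochastic P.
Proof.
split; last exact: tiar_kernel_stochastic.
by move=> x y; rewrite /tiar_kernel divr_ge0 ?ler0n.
Qed.

(** Right multiplication relabels the cards, while a move looks only at positions. *)
Lemma tiar_kernel_mulr x y g : P (x * g)%g (y * g)%g = P x y.
Proof.
rewrite /tiar_kernel; congr (_%:R / _); apply: eq_card => k.
by rewrite !inE /tiar_move mulgA (inj_eq (mulIg g)).
Qed.

Lemma kpow_mulr t x y g : kpow P t (x * g)%g (y * g)%g = kpow P t x y.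
Proof.
elim: t x => [|t IH] x /=; first by rewrite (inj_eq (mulIg g)).
rewrite (reindex_inj (mulIg g)) /=; apply: eq_bigr => z _.
by rewrite tiar_kernel_mulr IH.
Qed.

(** For each [k] the deck [x] has exactly one predecessor, in which the card in position [k] of [x]
    is back on top. *)
Lemma sum_kernel_transpose (F : S -> K) x :
  \sum_z F z * P z x = n.+1%:R^-1 * \sum_k F ((tiar_shift k)^-1 * x)%g.
Proof.
rewrite mulr_sumr /tiar_kernel.
under eq_bigr => z _ do
  rewrite -sum1dep_card natr_sum mulrA mulrC mulr_sumr mulr_sumr.
rewrite (exchange_big_dep xpredT) //=; apply: eq_bigr => k _.
rewrite (eq_bigl (pred1 ((tiar_shift k)^-1 * x)%g)); last first.
  by move=> z; rewrite /= /tiar_move -(inj_eq (mulgI (tiar_shift k)^-1%g)) mulKg.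
by rewrite big_pred1_eq mulr1.
Qed.

Lemma tiar_shiftE (k i : 'I_n.+1) :
  tiar_shift k i = (if (i < k)%N then i.+1 else if i == k then 0%N else i) :> nat.
Proof.
have := tiar_moveE k 1%g i; rewrite /tiar_move mulg1 => ->.
case: ifP => ik; last by case: ifP => _; rewrite perm1.
by rewrite perm1 inordK //; have := ltn_ord k; lia.
Qed.

(* The two decks agree on the positions of the cards of A, which lie on top. *)
Definition top_agree A x y :=
  (forall c, c \in A -> x^-1%g c = y^-1%g c) /\
  (forall c d, c \in A -> d \notin A ->
     (x^-1%g c < x^-1%g d)%N /\ (y^-1%g c < y^-1%g d)%N).

Definition card_to_top (c : 'I_n.+1) x : S :=
  ((tiar_shift (x^-1 c))^-1 * x)%g.

Lemma card_to_topV c x d :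
  ((card_to_top c x)^-1)%g d = tiar_shift (x^-1%g c) (x^-1%g d).
Proof. by rewrite /card_to_top invMg invgK permM. Qed.

(** If [c] is in [A], it has the same position in both decks and the block [A] is rearranged
    identically. Otherwise [c] lies below [A] in both decks: it goes to position 0 and every card of
    [A] goes down by one. *)
Lemma top_agree_step A x y c : top_agree A x y ->
  top_agree (c |: A) (card_to_top c x) (card_to_top c y).
Proof.
move=> [agr top].
have ne (z : S) (d e : 'I_n.+1) : d != e -> (z^-1%g d : nat) != z^-1%g e :> nat.
  by move=> de; rewrite (inj_eq val_inj) (inj_eq perm_inj).
have eqE (z : S) (d e : 'I_n.+1) : (z^-1%g d == z^-1%g e) = (d == e :> 'I_n.+1).
  by rewrite (inj_eq perm_inj).
split=> [d|d e].
  rewrite !card_to_topV => dA; apply: ord_inj; rewrite !tiar_shiftE !eqE.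
  have [->|dc] := eqVneq d c; first by rewrite !ltnn.
  move: dA; rewrite !inE (negbTE dc) /= => dA; rewrite (agr d dA).
  case cA : (c \in A); first by rewrite (agr c cA).
  have [/= h1 h2] := top d c dA (negbT cA).
  by move: h1; rewrite (agr d dA) => ->; rewrite h2.
rewrite !inE negb_or !card_to_topV !tiar_shiftE !eqE => dA /andP[ec eA].
rewrite (negbTE ec).
have nx := ne x _ _ ec; have ny := ne y _ _ ec.
have [dc|dc] := eqVneq d c.
  subst d; rewrite !ltnn.
  by case: ifP => h1; case: ifP => h2; split=> //; lia.
move: dA; rewrite (negbTE dc) /= => dA.
have [h1 h2] := top d e dA eA.
case cA : (c \in A).
  have [] := top c e cA eA => *.
  have := ne x _ _ dc; have := ne y _ _ dc.
  by split; do !case: ifP; lia.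
have [hx hy] := top d c dA (negbT cA); rewrite hx hy.
by split; case: ifP; lia.
Qed.

Local Notation rho := (1 - n.+1%:R^-1 : K).

(** Double counting: an uncovered card stays uncovered for all choices of [c] but itself. Averaged
    over the n + 1 choices, this is the contraction factor [rho]. *)
Lemma sum_card_uncovered A :
  \sum_c (#|~: (c |: A)|%:R : K) = #|~: A|%:R * n%:R.
Proof.
rewrite -natr_sum -natrM; congr _%:R.
under eq_bigr do rewrite -sum1_card.
rewrite (exchange_big_dep (fun d => d \in ~: A)) /=; last first.
  by move=> c d _; rewrite !inE negb_or => /andP[].
rewrite (eq_bigr (fun=> n)) ?sum_nat_const // => d; rewrite inE => dA.
rewrite sum1dep_card; transitivity #|[set~ d]%SET|; last by rewrite cardsC1 card_ord.
by apply: eq_card => c; rewrite !inE negb_or dA andbT eq_sym.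
Qed.

(* Drive both reversed chains by the label of the card that is moved to the top,
   rather than by its position; the decks coincide once all labels are seen. *)
Lemma reversed_coupling t A x y : top_agree A x y ->
  \sum_z `|kpow P t z x - kpow P t z y| <= 2 * #|~: A|%:R * rho ^+ t.
Proof.
elim: t A x y => [|t IH] A x y xyA.
  (* With no uncovered card the decks are equal; otherwise the trivial bound 2 between point masses
     suffices. *)
  rewrite expr0 mulr1; have [A0|An0] := eqVneq #|~: A| 0%N.
    suff -> : x = y by rewrite A0 mulr0 big1 // => z _; rewrite subrr normr0.
    apply: invg_inj; apply/permP => c; apply: (proj1 xyA).
    by move/eqP: A0; rewrite cards_eq0 => /eqP/setP/(_ c); rewrite !inE => /negbFE.
  apply: (@le_trans _ _ 2); last by rewrite ler_peMr // ler1n lt0n.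
  apply: (@le_trans _ _ (\sum_z (kpow P 0 z x + kpow P 0 z y))).
    apply: ler_sum => z _; apply: le_trans (ler_normB _ _) _.
    by rewrite /= !normr_nat.
  rewrite big_split /= (eq_bigr (fun z => (x == z)%:R * 1)); last first.
    by move=> z _; rewrite mulr1 eq_sym.
  rewrite (sum_point_mass (fun=> 1)) (eq_bigr (fun z => (y == z)%:R * 1)); last first.
    by move=> z _; rewrite mulr1 eq_sym.
  by rewrite (sum_point_mass (fun=> 1)).
have E (z v : S) : kpow P t.+1 z v =
    n.+1%:R^-1 * \sum_c kpow P t z (card_to_top c v).
  rewrite kpowSr sum_kernel_transpose; congr (_ * _).
  (* Cards and positions of [v] are in bijection, so a uniform position is a uniform label. *)
  by rewrite (reindex_inj (@perm_inj _ v^-1%g)).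
apply: (@le_trans _ _ (n.+1%:R^-1 * \sum_c
    \sum_z `|kpow P t z (card_to_top c x) - kpow P t z (card_to_top c y)|)).
  rewrite [X in _ <= _ * X]exchange_big mulr_sumr; apply: ler_sum => z _.
  rewrite !E -mulrBr normrM ger0_norm ?invr_ge0 ?ler0n //.
  by rewrite ler_wpM2l ?invr_ge0 ?ler0n // -sumrB ler_norm_sum.
apply: (@le_trans _ _ (n.+1%:R^-1 * \sum_c
    (2 * #|~: (c |: A)|%:R * rho ^+ t))).
  rewrite ler_wpM2l ?invr_ge0 ?ler0n //; apply: ler_sum => c _.
  by apply: IH; apply: top_agree_step.
rewrite -mulr_suml -mulr_sumr sum_card_uncovered exprS.
rewrite le_eqVlt; apply/orP; left; apply/eqP.
have n0 : (1 + n%:R : K) != 0 by rewrite nat1r pnatr_eq0.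
by rewrite -nat1r; field.
Qed.

Lemma tiar_mixing t x :
  \sum_y `|kpow P t x y - uniform_law K y| <= 2 * n.+1%:R * rho ^+ t.
Proof.
have sPt := kpow_stochastic _ t tiar_kernel_is_stochastic.
have -> : \sum_y `|kpow P t x y - uniform_law K y| =
          \sum_y `|kpow P t y x - uniform_law K y|.
  (* By right invariance [kpow P t x y] depends only on y x^-1; inverting the group element then
     turns a row into a column. *)
  transitivity (\sum_g `|kpow P t 1%g g - uniform_law K g|).
    rewrite (reindex_inj (mulIg x)) /=; apply: eq_bigr => g _.
    by rewrite -{1}[x]mul1g kpow_mulr.
  rewrite (reindex_inj (mulgI x)) (reindex_inj invg_inj) /=.
  apply: eq_bigr => y _.
  by rewrite -(kpow_mulr t _ _ y) mul1g mulgKV.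
set N : K := #|S|%:R.
have N0 : 0 < N by rewrite ltr0n; apply/card_gt0P; exists x.
apply: (@le_trans _ _ (N^-1 * \sum_x' \sum_y
    `|kpow P t y x - kpow P t y x'|)).
  rewrite exchange_big /= mulr_sumr; apply: ler_sum => y _.
  (* Since rows sum to 1, the uniform law is the average of [kpow P t y x'] over all endpoints
     [x']. *)
  have -> : kpow P t y x - uniform_law K y =
      N^-1 * \sum_x' (kpow P t y x - kpow P t y x').
    rewrite sumrB (proj2 sPt) sumr_const -[_ *+ _]mulr_natl -/N.
    by rewrite /uniform_law -/N mulrBr mulr1 mulKf // gt_eqF.
  by rewrite normrM gtr0_norm ?invr_gt0 // ler_wpM2l ?invr_ge0 ?(ltW N0) // ler_norm_sum.
rewrite mulrC ler_pdivrMr //.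
apply: (@le_trans _ _ (\sum_(x' : S) 2 * n.+1%:R * rho ^+ t)).
  apply: ler_sum => x' _.
  (* Any two decks agree on the empty block, which leaves all n + 1 cards uncovered. *)
  rewrite [X in _ * X%:R](_ : _ = #|~: (@finset.set0 'I_n.+1)|); last first.
    by rewrite finset.setC0 cardsT card_ord.
  by apply: reversed_coupling; split=> [c|c d]; rewrite inE.
by rewrite sumr_const -[_ *+ _]mulr_natr.
Qed.

End Mixing.

(** * The three conditions from numerical inequalities *)

Lemma uniform_law_target (K : realType) (n : nat) :
  \sum_(y in tiar_target n.+1) uniform_law K y = (n.+1)`!%:R^-1.
Proof. by rewrite big_set1 /uniform_law card_Sn. Qed.

(** Divided by n!, the bound on 2 R + 1 says that (2 R + 1) pi(G) is at most f pi(A); it serves both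
    condition E and the Markov bound on the complement of B and G. *)
Lemma tiar_HpG (K : realType) (n : nat) (alpha : K) (R : nat) (d f r : K) :
  0 < f -> (1 < n)%N ->
  (2 * R).+1%:R <= f * (n`!%:R - 1) ->
  2 * n%:R * (1 - n%:R^-1) ^+ R <= d ->
  f `^ (1 - alpha) + d < r ->
  HpG (@tiar_kernel K n) (@uniform_law K 'S_n) (tiar_target n)
      alpha R d f r.
Proof.
case: n => [//|n] f0; rewrite ltnS => n0 Rf ed fr.
set P := @tiar_kernel K n.+1; set pi := @uniform_law K 'S_n.+1.
set N : K := (n.+1)`!%:R.
have N1 : 1 < N by rewrite ltr1n; have := fact_gt0 n; rewrite factS; nia.
have N0 : 0 < N by apply: lt_trans N1.
have sP : stochastic P by exact: tiar_kernel_is_stochastic.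
have pi0 x : 0 < pi x by rewrite /pi /uniform_law card_Sn invr_gt0.
have ipi : invariant_law P pi by exact: tiar_kernel_invariant.
have piG := uniform_law_target K n.
have piA : \sum_(y in (~: tiar_target n.+1)%SET) pi y = 1 - N^-1.
  have piT : \sum_x pi x = 1.
    by rewrite sumr_const cardT -cardE -[_ *+ _]mulr_natr mulVf // card_Sn gt_eqF.
  rewrite -piT -piG [X in _ = X - _](bigID (mem (tiar_target n.+1))) /=.
  by rewrite addrC addrK; apply: eq_bigl => x; rewrite !inE.
have mix x : \sum_y `|kpow P R x y - pi y| <= d.
  exact: le_trans (tiar_mixing R x) ed.
have r0 : 0 < r.
  apply: le_lt_trans fr; apply: addr_ge0; first exact: powR_ge0.
  by apply: le_trans (mix 1%g); apply: sumr_ge0.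
have d0 : 0 <= d by apply: le_trans (mix 1%g); apply: sumr_ge0.
split.
- apply: cond_E_bound => //; rewrite ?piG ?piA -/N.
    rewrite -/N in Rf; apply: le_trans (ler_wpM2r _ Rf) _.
      by rewrite invr_ge0 ltW.
    by rewrite -mulrA mulrBl divff ?gt_eqF // mul1r.
  by rewrite subr_gt0 invf_lt1.
- rewrite /cond_T /dbar; apply: bigmax_le => // x _.
  apply: bigmax_le => // y _; rewrite /dTV.
  (* The triangle inequality through [pi] costs 2 [d], and the factor 1/2 of [dTV] absorbs the 2. *)
  rewrite mulrC ler_pdivrMr // mulr_natr mulr2n.
  apply: le_trans (lerD (mix x) (mix y)); rewrite -big_split /=.
  apply: ler_sum => z _; rewrite !law_atE.
  rewrite [`|kpow P R y z - _|]distrC.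
  by apply: le_trans (ler_normD _ _); rewrite addrA subrK.
- rewrite /cond_Rc; apply: bigmax_lt => // x _.
  apply: le_lt_trans fr; apply: le_trans (prob_hit_gt_le_last _ _ _ _ sP) _.
  set B := (_ :|: _)%SET.
  apply: (@le_trans _ _ (\sum_(y | y \notin B) pi y +
      \sum_(y | y \notin B) `|kpow P R x y - pi y|)).
    rewrite -big_split /=; apply: ler_sum => y _.
    by rewrite -lerBlDl ler_norm.
  apply: lerD; last first.
    apply: le_trans (mix x); rewrite [leRHS](bigID (fun y => y \notin B)) /=.
    by rewrite lerDl sumr_ge0.
  have fa0 : 0 < f `^ alpha by rewrite powR_gt0.
  (* Multiplying by f^alpha turns the target f^(1 - alpha) into [f], the form of the Markov
     bound. *)
  rewrite -(ler_pM2r fa0) -powRD ?subrK ?powRr1 ?(ltW f0) //; last first.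
    by rewrite (gt_eqF f0) implybT.
  apply: le_trans (Bset_compl_bound P pi _ sP pi0 ipi alpha R f f0) _.
  rewrite piG ler_pdivrMr //; apply: le_trans Rf _.
  by rewrite ler_wpM2l ?(ltW f0) // lerBlDl ler_wpDl.
Qed.

(** * Asymptotic estimates and the choice of sequences *)

Lemma coupon_tail (K : realType) (n R : nat) : (0 < n)%N ->
  3 * (n%:R * ln n%:R) <= R%:R :> K ->
  n%:R * (1 - n%:R^-1) ^+ R <= n%:R ^- 2 :> K.
Proof.
move=> n0 hR; have N0 : 0 < n%:R :> K by rewrite ltr0n.
(* With 1 - u <= exp(-u) at u = 1/n, it remains to see that 3 ln n <= R / n. *)
have -> : n%:R ^- 2 = n%:R * expR (- (3 * ln n%:R)) :> K.
  rewrite expRN expRM_natl lnK ?posrE //.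
  by field; rewrite gt_eqF.
rewrite ler_wpM2l ?(ltW N0) //.
apply: (@le_trans _ _ (expR (- n%:R^-1) ^+ R)).
  apply: lerXn2r; rewrite ?nnegrE ?expR_ge0 //.
    by rewrite subr_ge0 invf_le1 // ler1n.
  exact: expR_ge1Dx.
rewrite -expRM_natl ler_expR mulrN lerN2.
by rewrite ler_pdivlMr // -mulrA [_ * n%:R]mulrC.
Qed.

Lemma fact_bound (n R : nat) : (8 <= n)%N -> (0 < R <= (n - 2)`!)%N ->
  ((2 * R).+1 * (n + 2) <= n`! - 1)%N.
Proof.
case: n => [|[|n]] // n8; rewrite subn2 /= => /andP[R0 RF].
rewrite !factS; move: (n`!) RF => F RF.
(* Since 2 R + 1 <= 3 R <= 3 F, the first term dominates the product; the extra F >= 1 pays for the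
   subtracted 1. *)
have h : (3 * F * (n.+2 + 2) + F <= n.+2 * (n.+1 * F))%N.
  have -> : (3 * F * (n.+2 + 2) + F = (3 * n + 13) * F)%N by lia.
  by rewrite mulnA leq_mul2r; apply/orP; right; nia.
have : ((2 * R).+1 * (n.+2 + 2) <= 3 * F * (n.+2 + 2))%N.
  by rewrite leq_mul2r; apply/orP; right; lia.
lia.
Qed.

Lemma much_less_le {K : realType} {a b : nat -> K} {c : K} :
  0 < c -> much_less a b -> (forall n, 0 <= a n) -> (forall n, 0 <= b n) ->
  \forall n \near \oo, 0 < b n /\ a n <= c * b n.
Proof.
move=> c0 [bn0 /cvgr0Pnorm_le /(_ c c0) abc] a0 b0.
near=> n.
have bn : 0 < b n by rewrite lt_neqAle b0 andbT eq_sym; near: n.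
split=> //; rewrite -ler_pdivrMr //; apply: le_trans (ler_norm _) _.
by near: n.
Unshelve. all: by end_near. Qed.

Lemma cvg_inv_shift (K : realType) : (fun n => (n + 2)%:R^-1 : K) @ \oo --> (0 : K).
Proof.
have := @cvg_harmonic K; rewrite -cvg_shiftS; apply: cvg_trans.
by apply: near_eq_cvg; near=> n; rewrite /harmonic addn2.
Unshelve. all: by end_near. Qed.

Theorem theorem4p5 (K : realType) (alpha : K) (halpha : 0 < alpha < 1)
    (R : nat -> nat)
    (hlow : much_less (fun n => n%:R * ln n%:R : K) (fun n => (R n)%:R))
    (hupp : much_less (fun n => (R n)%:R : K) (fun n => ((n - 2)`!)%:R)) :
  exists d f r : nat -> K,
    [/\ (forall n, [/\ 0 < d n < 1, 0 < f n < 1 & 0 < r n < 1]),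
        d @ \oo --> (0 : K),
        f @ \oo --> (0 : K),
        r @ \oo --> (0 : K) &
        \forall n \near \oo,
          HpG (@tiar_kernel K n) (@uniform_law K 'S_n) (tiar_target n)
              alpha (R n) (d n) (f n) (r n)].
Proof.
case/andP: halpha => a0 a1.
pose f n : K := (n + 2)%:R^-1.
pose v n : K := f n `^ (1 - alpha).
(* As f <= v, the factor 3 makes v + f < r strict. The value 1/2 only keeps [r] in (0, 1) for the
   finitely many n where 3 v is too large. *)
pose r n := if 3 * v n < 1 then 3 * v n else 2^-1.
have f01 n : 0 < f n < 1.
  by rewrite /f addn2 invr_gt0 ltr0n invf_lt1 ?ltr0n // ltr1n.
have fcvg : f @ \oo --> (0 : K) := @cvg_inv_shift K.
have v0 n : 0 < v n by rewrite powR_gt0 //; case/andP: (f01 n).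
have fv n : f n <= v n.
  case/andP: (f01 n) => f0 f1; rewrite -[leLHS]powRr1 ?(ltW f0) // /v.
  by rewrite ger_powR ?f0 ?(ltW f1) // gerBl ltW.
have v3cvg : (fun n => 3 * v n) @ \oo --> (0 : K).
  rewrite -[X in _ --> X](mulr0 3); apply: cvgM; first exact: cvg_cst.
  have h : 0 < 1 - alpha by rewrite subr_gt0.
  have /cvg_at_rightP := powR_cvg0 h; apply; split=> //.
  by move=> n; case/andP: (f01 n).
have v3lt : \forall n \near \oo, 3 * v n < 1.
  exact: (cvgr_lt 0 v3cvg _ ltr01).
exists f, f, r; split=> //.
- move=> n; split=> //; rewrite /r; case: ifP => [->|_].
    by rewrite mulr_gt0.
  by rewrite invr_gt0 ltr0n invf_lt1 ?ltr0n // ltr1n.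
- apply: cvg_trans v3cvg; apply: near_eq_cvg.
  by near=> n; rewrite /r ifT //; near: n.
(* The ratio 1/3 matches the constant 3 of [coupon_tail]. *)
have third : 0 < 3^-1 :> K by rewrite invr_gt0.
have nln0 n : 0 <= n%:R * ln n%:R :> K.
  case: n => [|n]; first by rewrite mul0r.
  by rewrite mulr_ge0 // ln_ge0 // ler1n.
have R_ge0 n : 0 <= (R n)%:R :> K by [].
have low := much_less_le third hlow nln0 R_ge0.
have upp := @much_less_le K _ _ 1 ltr01 hupp R_ge0 (fun n => ler0n K _).
near=> n.
have n8 : (8 <= n)%N by near: n; exact: nbhs_infty_ge.
have lown : 0 < (R n)%:R :> K /\ n%:R * ln n%:R <= 3^-1 * (R n)%:R :> K.
  by near: n.
have uppn : 0 < ((n - 2)`!)%:R :> K /\ (R n)%:R <= 1 * ((n - 2)`!)%:R :> K.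
  by near: n.
have v3 : 3 * v n < 1 by near: n.
move: lown uppn => [R0 lowR] [_ uppR].
have nK : 8 <= n%:R :> K by rewrite (ler_nat _ 8).
have tail : n%:R * (1 - n%:R^-1) ^+ R n <= n%:R ^- 2 :> K.
  by apply: coupon_tail; [exact: leq_trans n8|rewrite -ler_pdivlMl].
have fb : ((2 * R n).+1 * (n + 2) <= n`! - 1)%N.
  apply: fact_bound => //; move: R0 uppR.
  by rewrite mul1r ltr0n ler_nat => -> ->.
have fn0 : 0 < f n by case/andP: (f01 n).
have tail2 : 2 * n%:R * (1 - n%:R^-1) ^+ R n <= f n.
  rewrite -mulrA; apply: (@le_trans _ _ (2 * n%:R ^- 2)).
    by rewrite ler_pM2l.
  (* This reduces to 2 (n + 2) <= n^2, which n >= 8 ensures. *)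
  rewrite /f ler_pdivrMr ?exprn_gt0 ?(lt_le_trans _ nK) //.
  rewrite mulrC ler_pdivlMr ?ltr0n ?addn2 // -addn2 natrD.
  by nra.
have Rf : (2 * R n).+1%:R <= f n * (n`!%:R - 1).
  rewrite mulrC ler_pdivlMr ?ltr0n ?addn2 // -natrM -[1]/(1%:R).
  by rewrite -natrB ?fact_gt0 // ler_nat -[n.+2]addn2.
have rn : v n + f n < r n.
  by rewrite /r v3; have := fv n; have := v0 n; lra.
by apply: tiar_HpG => //; apply: leq_trans n8.
Unshelve. all: by end_near. Qed.
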